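(* Consider a stationary VLMC $(U_n)_{n\ge0}$ defined by a probabilized bamboo blossom, with stationary probability measure $\pi$ and process of final letters $X=(X_n)_{n\ge0}$. Let $w=w_1\cdots w_k$ be a finite word of one of the forms listed in (i), (ii) below, where $\ell\in\mathbb N$ and $*$ stands for any finite (possibly empty) word. Then, for $|x|<1$, the generating function of the position of the first occurrence of $w$ in $X$ is $$\Phi_w^{(1)}(x)=\frac{x^k\pi(w)}{(1-x)S_w(x)}$$ and, for every $r\ge1$, the generating function of the position of the $r$-th occurrence of $w$ is $$\Phi_w^{(r)}(x)=\Phi_w^{(1)}(x)\left(1-\frac1{S_w(x)}\right)^{r-1},$$ where: (i) if $w$ is of the form $*00(10)^\ell$ or $*11(01)^\ell0$, $$S_w(x)=C_w(x)+\sum_{j=k}^\infty q^{(j)}_{\mathrm{pref}(w)}(w)x^j,\qquad C_w(x)=1+\sum_{j=1}^{k-1}\mathbf 1_{\{w_{j+1}\cdots w_k=w_1\cdots w_{k-j}\}}\,q^{(j)}_{\mathrm{pref}(w)}(w_{k-j+1}\cdots w_k)x^j;$$ (ii) if $w$ is of the form $*00(10)^\ell1$, $$S_w(x)=C_w(x)+\sum_{j=k}^\infty q^{(j)}_{1(01)^\ell00}(w)x^j,\qquad C_w(x)=1+\sum_{j=1}^{k-1}\mathbf 1_{\{w_{j+1}\cdots w_k=w_1\cdots w_{k-j}\}}\,q^{(j)}_{1(01)^\ell00}(w_{k-j+1}\cdots w_k)x^j,$$ and if $w$ is of the form $*11(01)^\ell$, $$S_w(x)=C_w(x)+\sum_{j=k}^\infty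 q^{(j)}_{(10)^\ell11}(w)x^j,\qquad C_w(x)=1+\sum_{j=1}^{k-1}\mathbf 1_{\{w_{j+1}\cdots w_k=w_1\cdots w_{k-j}\}}\,q^{(j)}_{(10)^\ell11}(w_{k-j+1}\cdots w_k)x^j.$$
   Context: **Words.** $\mathcal A=\{0,1\}$, $\mathbb N=\{0,1,2,\dots\}$; $\mathcal L=\mathcal A^{-\mathbb N}$ is the set of left-infinite sequences $\cdots\alpha_{-1}\alpha_0$, with the $\sigma$-algebra generated by the cylinders $\mathcal Lw=\{s\in\mathcal L:\ w\text{ is a suffix of }s\}$, $w$ a finite word. $\overline w$ is the reversed word of $w$; for $s=\cdots\alpha_{-1}\alpha_0\in\mathcal L$, $\overline s=\alpha_0\alpha_{-1}\cdots$. Notation: $\pi(w):=\pi(\mathcal Lw)$; $|u|$ is the length of $u$. **Bamboo blossom.** It is the saturated tree whose internal nodes are the words $(01)^n$ and $(01)^n0$, $n\ge0$, and whose leaves (contexts) are the finite words $(01)^n1$ and $(01)^n00$, $n\ge0$, together with the right-infinite word $(01)^\infty$. To each context $c$ is attached a probability measure $q_c$ on $\mathcal A$. **VLMC.** For $s\in\mathcal L$, $\mathrm{pref}(s)$ is the unique context that is a prefix of $\overline s$ (or equals $\overline s$). The VLMC is the $\mathcal L$-valued Markov chain $(U_n)$ with transitions $\mathbf P(U_{n+1}=U_n\alpha\mid U_n)=q_{\mathrm{pref}(U_n)}(\alpha)$; it is stationary when $U_0$ has a stationary distribution $\pi$. $X_n$ is the last letter of $U_n$; for indices $m\le0$, $X_m$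 denotes the corresponding letter of $U_0=\cdots X_{-1}X_0$. For a finite word $w$ such that $\overline w$ is not an internal node, $\mathrm{pref}(w)$ is the unique finite context $c$ such that $\overline c$ is a suffix of $w$. **Occurrences.** $w$ of length $k$ occurs at position $n\ge k$ if $X_{n-k+1}\cdots X_n=w$. $T_w^{(r)}$ is the position of the $r$-th occurrence of $w$ (possibly $+\infty$) and $\Phi_w^{(r)}(x)=\sum_{n\ge0}\mathbf P(T_w^{(r)}=n)x^n$. **Notation $q_v^{(n)}(u)$.** For finite words $u,v$ and $n\ge0$, $q_v^{(n)}(u)=\mathbf P\left(X_{n-|u|+1}\cdots X_n=u\mid X_{-(|v|-1)}\cdots X_0=\overline v\right)$ (the conditional probability being assumed to be well defined). *)

(* Defs.v *)
From HB Require Import structures.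
From mathcomp Require Import all_boot all_order all_algebra.
From mathcomp Require Export complex.
From mathcomp Require Import all_classical all_reals all_analysis.
Set Implicit Arguments.
Unset Strict Implicit.
Unset Printing Implicit Defensive.
Import Order.TTheory GRing.Theory Num.Theory.
Import numFieldNormedType.Exports.
Local Open Scope classical_set_scope.
Local Open Scope complex_scope.
Local Open Scope ring_scope.

(* The alphabet {0,1} is bool, with 0 = false and 1 = true. *)
Definition word := seq bool.

Definition word_pow (u : word) (n : nat) : word := flatten (nseq n u).

Notation w00 := [:: false; false].
Notation w01 := [:: false; true].
Notation w10 := [:: true; false].
Notation w11 := [:: true; true].

(* A left-infinite sequence ...alpha_{-1} alpha_0 is encoded by the function
   i |-> alpha_{-i}.  Read as a right-infinite sequence, the same function is
   therefore the reversed sequence alpha_0 alpha_{-1}... *)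
Definition last_letters (s : nat -> bool) (n : nat) : word := rev (mkseq s n).

Definition cylinder (w : word) : set (nat -> bool) :=
  [set s | last_letters s (size w) = w].

Notation lseq := (g_sigma_algebraType (range cylinder)).

Definition snoc (s : lseq) (a : bool) : lseq :=
  fun i => if i is j.+1 then (s : nat -> bool) j else a.

(* Leaves of the bamboo blossom: (01)^n 1, (01)^n 00 and (01)^oo. *)
Inductive context := ctx1 of nat | ctx00 of nat | ctx_inf.
HB.instance Definition _ := gen_eqMixin context.
HB.instance Definition _ := gen_choiceMixin context.

Definition context_word (c : context) : option word :=
  match c with
  | ctx1 n => Some (word_pow w01 n ++ [:: true])
  | ctx00 n => Some (word_pow w01 n ++ w00)
  | ctx_inf => None
  end.

(* The letter of rank i of the right-infinite word (01)^oo is 1 iff i is odd. *)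
Definition context_of (s : lseq) (c : context) : Prop :=
  if context_word c is Some u then mkseq s (size u) = u
  else forall i, (s : nat -> bool) i = odd i.

Definition pref (s : lseq) : context := xget ctx_inf (context_of s).

Definition finite_context (u : word) : Prop :=
  exists c, context_word c = Some u.

(* The default value [::] is only reached when the reversed word of w is an
   internal node. *)
Definition pref_word (w : word) : word :=
  xget [::] [set u | finite_context u /\ suffix (rev u) w].

Lemma size_word_pow2 (a b : bool) n : size (word_pow [:: a; b] n) = n.*2.
Proof. by elim: n => //= n; rewrite /word_pow /= => ->; rewrite doubleS. Qed.

Lemma nth_word_pow01 n i : (i < n.*2)%N ->
  nth false (word_pow w01 n) i = odd i.
Proof.
elim: n i => // n IHn [|[|i]] //=; rewrite doubleS !ltnS => /IHn.
by rewrite /word_pow => ->; rewrite negbK.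
Qed.

Lemma context_ofE s c : context_of s c <->
  match c with
  | ctx1 n => (forall i, (i < n.*2)%N -> s i = odd i) /\ s n.*2 = true
  | ctx00 n => (forall i, (i < n.*2.+1)%N -> s i = odd i) /\
               s n.*2.+1 = false
  | ctx_inf => forall i, s i = odd i
  end.
Proof.
have aux (u : word) : mkseq s (size u) = u <->
    forall i, (i < size u)%N -> s i = nth false u i.
  split=> [h i iu|h]; first by rewrite -[in RHS]h nth_mkseq.
  apply: (@eq_from_nth _ false); rewrite size_mkseq // => i iu.
  by rewrite nth_mkseq // h.
rewrite /context_of; case: c => [n|n|] //=; rewrite aux size_cat size_word_pow2.
- rewrite /= addn1; split=> [h|[h1 h2] i].
    split=> [i ilt|].
      by rewrite h ?ltnS 1?ltnW // nth_cat size_word_pow2 ilt nth_word_pow01.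
    by rewrite h // nth_cat size_word_pow2 ltnn subnn.
  rewrite nth_cat size_word_pow2 ltnS leq_eqVlt => /predU1P[->|ilt].
    by rewrite ltnn subnn.
  by rewrite ilt nth_word_pow01 // h1.
- rewrite /= addn2; split=> [h|[h1 h2] i].
    split=> [i|].
      rewrite ltnS leq_eqVlt => /predU1P[->|ilt].
        by rewrite h ?ltnS 1?ltnW // nth_cat size_word_pow2 ltnn subnn odd_double.
      rewrite h ?nth_cat ?size_word_pow2 ?ilt ?nth_word_pow01 //.
      by rewrite !ltnS ltnW // ltnW.
    by rewrite h // nth_cat size_word_pow2 ltnNge leqnSn subSnn.
  rewrite nth_cat size_word_pow2 ltnS leq_eqVlt => /predU1P[->|].
    by rewrite ltnNge leqnSn subSnn.
  move=> ilt; rewrite h1 //; move: ilt; rewrite ltnS leq_eqVlt => /predU1P[->|ilt].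
    by rewrite ltnn subnn odd_double.
  by rewrite ilt nth_word_pow01.
Qed.

Lemma context_of_exists s : exists c, context_of s c.
Proof.
have [h|/existsNP[i0 /eqP hi0]] := pselect (forall i, (s : nat -> bool) i = odd i).
  by exists ctx_inf; rewrite context_ofE.
have ex : exists i, (s : nat -> bool) i != odd i by exists i0.
have [m hm mmin] := ex_minnP ex.
have below i : (i < m)%N -> (s : nat -> bool) i = odd i.
  by move=> im; apply/eqP/negPn/negP => /mmin; rewrite leqNgt im.
case om : (odd m).
- exists (ctx00 m./2); rewrite context_ofE.
  have -> : (m./2).*2.+1 = m by rewrite -[RHS]odd_double_half om.
  by split=> //; move: hm; rewrite om; case: (s m).
- exists (ctx1 m./2); rewrite context_ofE.
  have -> : (m./2).*2 = m by rewrite -[RHS]odd_double_half om.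
  by split=> //; move: hm; rewrite om; case: (s m).
Qed.

Lemma context_of_unique s c d : context_of s c -> context_of s d -> c = d.
Proof.
pose f c := match c with ctx1 n => Some n.*2 | ctx00 n => Some n.*2.+1
  | ctx_inf => None end.
have fI c1 c2 : f c1 = f c2 -> c1 = c2.
  case: c1 c2 => [n|n|] [m|m|] //= [].
  - by move=> /double_inj ->.
  - by move=> /(congr1 odd); rewrite /= !odd_double.
  - by move=> /(congr1 odd); rewrite /= !odd_double.
  - by move=> /double_inj ->.
pose g (o : option nat) := match o with
  | Some m => (forall i, (i < m)%N -> s i = odd i) /\ s m = ~~ odd m
  | None => forall i, s i = odd i end.
have fg e : context_of s e -> g (f e).
  by rewrite context_ofE; case: e => [n|n|] //= [h ->];
    rewrite ?odd_double.
move=> /fg gc /fg gd; apply: fI; move: gc gd.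
case: (f c) (f d) => [m|] [n|] //=.
- move=> [h1 h2] [h3 h4]; congr Some; apply/eqP; rewrite eqn_leq.
  apply/andP; split; rewrite leqNgt; apply/negP.
    by move=> /h1 e; move: h4; rewrite e; case: odd.
  by move=> /h3 e; move: h2; rewrite e; case: odd.
- by move=> [_ h] h'; move: h; rewrite h'; case: odd.
- by move=> h' [_ h]; move: h; rewrite h'; case: odd.
Qed.

Lemma prefP s : context_of s (pref s).
Proof. exact: xgetPex (context_of_exists s). Qed.

Lemma prefE s c : context_of s c -> pref s = c.
Proof. exact: context_of_unique (prefP s). Qed.

Lemma pref_wordE w u : finite_context u -> suffix (rev u) w -> pref_word w = u.
Proof.
move=> hu uw.
have [[d hd] dw] : finite_context (pref_word w) /\ suffix (rev (pref_word w)) w.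
  by apply: (@xgetPex _ [::] [set u | finite_context u /\ suffix (rev u) w]);
    exists u.
case: hu => c hc.
pose s : lseq := fun i => nth false (rev w) i.
have pre v : suffix (rev v) w -> mkseq s (size v) = v.
  rewrite /suffix revK => /prefixP[t wt].
  apply: (@eq_from_nth _ false); rewrite size_mkseq // => i iv.
  by rewrite nth_mkseq // /s wt nth_cat iv.
have := @context_of_unique s c d; rewrite /context_of hc hd !pre // => /(_ erefl erefl) E.
by move: hc; rewrite E hd => -[].
Qed.

Section chain.
Context {d : measure_display} {T : measurableType d} {R : realType}
  {P : probability T R}.
Variables (q : context -> probability bool R) (U : nat -> {RV P >-> lseq}).

Definition past (n : nat) : set (set T) :=
  <<s \bigcup_(i in [set i | (i <= n)%N])
        preimage_set_system [set: T] (U i) measurable >>.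

(* The conditional probability of U_{n+1} = U_n a given U_0, ..., U_n is
   q_{pref(U_n)}(a). *)
Definition VLMC : Prop := forall (n : nat) (a : bool) (E : set T), past n E ->
  P (E `&` [set t | U n.+1 t = snoc (U n t) a]) =
  (\int[P]_(t in E) q (pref (U n t)) [set a])%E.

Definition stationary_distribution (pi : probability lseq R) : Prop :=
  forall B : set lseq, measurable B ->
  pi B = (\int[pi]_s \sum_(a : bool) q (pref s) [set a] * \d_(snoc s a) B)%E.

Definition letter (m : int) (t : T) : bool :=
  match m with
  | Posz n => (U n t : nat -> bool) 0%N
  | Negz n => (U 0%N t : nat -> bool) n.+1
  end.

(* X_{n-k+1} ... X_n *)
Definition block (n k : nat) (t : T) : word :=
  mkseq (fun i => letter (n%:Z - k%:Z + i.+1%:Z) t) k.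

Definition cond_prob (E F : set T) : R := fine (P (E `&` F)) / fine (P F).

(* cond_word v n u is q_v^(n)(u). *)
Definition cond_word (v : word) (n : nat) (u : word) : R :=
  cond_prob [set t | block n (size u) t = u]
            [set t | block 0 (size v) t = rev v].

Definition occurs (w : word) (t : T) (n : nat) : bool :=
  (size w <= n)%N && (block n (size w) t == w).

(* None stands for +oo. *)
Definition occ_time (w : word) (r : nat) (t : T) : option nat :=
  xget None [set Some n | n in
    [set n | occurs w t n /\ count (occurs w t) (iota 0 n.+1) = r]].

(* The limits are taken in R[i]^o, which carries the norm topology of R[i]. *)
Definition occ_gf (w : word) (r : nat) (x : R[i]) : R[i] :=
  limn (series (fun n =>
    (fine (P [set t | occ_time w r t = Some n]))%:C * x ^+ n : R[i]^o)).

Definition autocorrelation (v w : word) (x : R[i]) : R[i] :=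
  1 + \sum_(1 <= j < size w | drop j w == take (size w - j) w)
        (cond_word v j (drop (size w - j) w))%:C * x ^+ j.

Definition occ_S (v w : word) (x : R[i]) : R[i] :=
  autocorrelation v w x +
  limn (fun n => \sum_(size w <= j < n) (cond_word v j w)%:C * x ^+ j : R[i]^o).

End chain.

(* Main.v *)
Require Import Defs.
From HB Require Import structures.
From mathcomp Require Import all_boot all_order all_algebra.
From mathcomp Require Import all_classical all_reals all_analysis.
From mathcomp Require Import measurable_realfun measurable_fun_approximation.
Import Order.TTheory GRing.Theory Num.Theory.
Import numFieldNormedType.Exports.
Local Open Scope classical_set_scope.
Local Open Scope complex_scope.
Local Open Scope ring_scope.

(** The theorem is a renewal argument.  In the bamboo blossom a finite context is
an alternating word 0101... that ends with its first fault, so the context of a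
past that contains 00 or 11 is determined by the letters from the last such
double letter on, and this stays true whatever letters are appended
([pref_has_double]).  In every listed case the reversal of v is a suffix of w
that contains a double letter ([conditioning_word]): once w has been read, the
probabilities of the next letters are products of transition probabilities that
depend on v only ([path_prob]).

Let u_n be the probability, from a past ending with w, that the n-th next
letter completes an occurrence of w, and f_n the probability that it completes
the first one.  Cutting a path at its first return gives
u_n = sum_m f_m u_(n-m) for n > 0, with u_0 = 1, hence S (1 - F) = 1 for the
generating functions ([renewal_gf]); in particular S does not vanish in the
unit disc.  This S is S_w(x): for j >= k the word w occurs inside the j new
letters and u_j is q_v^(j)(w), while for j < k an occurrence overlaps the old
one, which requires w to have a border and prescribes the new letters; these
terms make up C_w(x) ([autocorrelationE], [occ_S_cvg]).

By stationarity w occurs at each position n >= k with probability pi(w).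
Cutting a path at its first occurrence of w gives
Phi^(1)(x) S(x) = pi(w) x^k / (1 - x); cutting it at its r-th occurrence gives
Phi^(r+1) = Phi^(r) F, where F = 1 - 1/S.  Both identities, as well as the
renewal equation, are instances of [convolution], a statement on finite words.

Measure theory is used only to express probabilities as sums over finite words:
almost surely each state extends the previous one by a letter ([almost_step]),
every state has law pi ([state_law]), and so X_(n-k+1) ... X_n = h has
probability pi(h) ([block_law]), which equals pi(h') times a product of
transition probabilities when h starts with a word h' that contains a double
letter ([word_prob_cat]). *)

(** * Complex power series with bounded coefficients *)

Section power_series.
Context {R : realType}.
Implicit Types (a b : nat -> R) (x l : R[i]).

Lemma complex_norm_lt1 x : `|x| < 1 -> exists2 r : R, 0 <= r < 1 & `|x| = r%:C.
Proof.
rewrite normc_def => h.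
exists (Num.sqrt ((complex.Re x) ^+ 2 + (complex.Im x) ^+ 2)) => //.
by rewrite sqrtr_ge0 -ltcR.
Qed.

(** The norm of R[i] takes its values in R[i]; a real majorant reduces complex
limits to real ones. *)
Lemma complex_cvg_dominated (u : nat -> R[i]) (l : R[i]) (e : nat -> R) :
  (forall n, `|l - u n| <= (e n)%:C) -> e @ \oo --> (0 : R) ->
  (u : nat -> R[i]^o) @ \oo --> (l : R[i]^o).
Proof.
move=> ule /cvgrPdist_lt e0; apply/cvgrPdist_lt => d d0.
have dE : d = (complex.Re d)%:C by rewrite RRe_real // gtr0_real.
have d'0 : 0 < complex.Re d by rewrite -ltcR -dE.
apply: filterS (e0 _ d'0) => n; rewrite sub0r normrN => en.
apply: le_lt_trans (ule n) _; rewrite dE ltcR.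
by apply: le_lt_trans en; exact: ler_norm.
Qed.

Definition power_sum a x n : R[i]^o := \sum_(0 <= j < n) (a j)%:C * x ^+ j.

Lemma power_sum0 a x : power_sum a x 0 = 0 :> R[i].
Proof. by rewrite /power_sum big_geq. Qed.

Lemma power_sumS a x n :
  power_sum a x n.+1 = power_sum a x n + (a n)%:C * x ^+ n :> R[i].
Proof. by rewrite /power_sum big_nat_recr. Qed.

Definition power_cvg a x l := power_sum a x @ \oo --> (l : R[i]^o).

Lemma power_cvg_unique a x l l' : power_cvg a x l -> power_cvg a x l' -> l = l'.
Proof. by move=> h1 h2; apply: (cvg_unique _ h1 h2); exact: norm_hausdorff. Qed.

Lemma power_cvg_lim a x l : power_cvg a x l -> limn (power_sum a x) = l.
Proof. by move=> h; apply: cvg_lim => //; exact: norm_hausdorff. Qed.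

(** The real and the imaginary parts converge absolutely, by comparison with a
geometric series. *)
Lemma is_power_cvg a x : (forall n, `|a n| <= 1) -> `|x| < 1 ->
  exists l, power_cvg a x l.
Proof.
move=> a1 /complex_norm_lt1[r /andP[r0 r1] xr].
have cvgp (f : R[i] -> R) : (forall z, `|f z|%:C <= `|z|) ->
  cvgn (series (fun n => f ((a n)%:C * x ^+ n))).
  move=> fz; apply: normed_cvg.
  apply: (@series_le_cvg _ _ (geometric 1 r)) => [n|n|n|].
  - exact: normr_ge0.
  - by rewrite /geometric /= mul1r exprn_ge0.
  - rewrite /geometric /= mul1r -lecR; apply: le_trans (fz _) _.
    rewrite normrM normrX xr -rmorphXn /= normc_def /= expr0n addr0 sqrtr_sqr.
    by rewrite -rmorphM lecR ler_piMl // exprn_ge0.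
  - by apply: is_cvg_geometric_series; rewrite ger0_norm.
have /cvg_ex[/= lR hR] := cvgp (@complex.Re R) (@normc_ge_Re R).
have /cvg_ex[/= lI hI] : cvgn (series (fun n => complex.Im ((a n)%:C * x ^+ n))).
  apply: cvgp => z; have := normc_ge_Re (z * 'i%C); rewrite ReiNIm normrN => h.
  apply: le_trans h _; rewrite normrM normc_def.
  by rewrite (normc_def 'i%C) /= expr0n expr1n add0r sqrtr1 mulr1.
exists (lR +i* lI).
apply: (@complex_cvg_dominated _ _ (fun n =>
   `|lR - series (fun n => complex.Re ((a n)%:C * x ^+ n)) n| +
   `|lI - series (fun n => complex.Im ((a n)%:C * x ^+ n)) n|)).
- move=> n.
  have -> : power_sum a x n = series (fun n => complex.Re ((a n)%:C * x ^+ n)) n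
     +i* series (fun n => complex.Im ((a n)%:C * x ^+ n)) n.
    rewrite /power_sum /series /=; elim: n => [|n IH].
      by rewrite !big_geq.
    by rewrite !big_nat_recr //= IH; case: (_ * x ^+ n).
  set A := series _ n; set B := series _ n.
  rewrite [X in `|X|](_ : _ = (lR - A)%:C + 'i%C * (lI - B)%:C); last first.
    exact: (complexE ((lR - A) +i* (lI - B))).
  apply: le_trans (ler_normD _ _) _; rewrite [X in _ <= X]rmorphD lerD //.
    by rewrite normc_def /= expr0n addr0 sqrtr_sqr.
  by rewrite normrM !normc_def /= !expr0n expr1n add0r addr0 sqrtr1 mul1r sqrtr_sqr.
- rewrite -[X in _ --> X](addr0 (0 : R)).
  have dist0 (f : nat -> R) (c : R) : f @ \oo --> c ->
      (fun n => `|c - f n|) @ \oo --> (0 : R).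
    move=> fc; rewrite -(@normr0 _ R) -(subrr c).
    by apply: cvg_norm; apply: cvgB => //; exact: cvg_cst.
  by apply: cvgD; exact: dist0.
Qed.

(** With s the square root of r, n s^n <= 1 + s + ... + s^(n-1) < 1 / (1 - s),
hence n r^n <= s^n / (1 - s). *)
Lemma cvg_natr_expr (r : R) : 0 <= r -> r < 1 ->
  (fun n => n%:R * r ^+ n) @ \oo --> (0 : R).
Proof.
move=> r0 r1; pose s := Num.sqrt r.
have s0 : 0 <= s by exact: sqrtr_ge0.
have s1 : s < 1 by rewrite -sqrtr1 ltr_sqrt.
have ns n : n%:R * s ^+ n <= (1 - s)^-1.
  rewrite -[X in _ <= X]mul1r ler_pdivlMr ?subr_gt0 //.
  apply: (@le_trans _ _ (1 - s ^+ n)); last by rewrite gerBl exprn_ge0.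
  rewrite -[X in _ <= X - _](expr1n _ n) subrXX mulrC.
  apply: ler_wpM2l; first by rewrite subr_ge0 ltW.
  rewrite mulr_natl -[X in _ *+ X]card_ord -sumr_const; apply: ler_sum => i _.
  by rewrite expr1n mul1r; apply: ler_wiXn2l => //; [exact: ltW|exact: ltnW].
have := cvg_geometric ((1 - s)^-1) (_ : `|s| < 1).
rewrite ger0_norm // => /(_ s1) h.
apply: (@squeeze_cvgr _ _ _ _ (fun=> 0) (geometric (1 - s)^-1 s)) => //.
  apply: nearW => n; rewrite mulr_ge0 ?exprn_ge0 //= /geometric /=.
  rewrite -[X in X ^+ _](sqr_sqrtr r0) -exprM mulnC exprM -/s expr2 mulrA.
  by rewrite ler_wpM2r // exprn_ge0.
exact: cvg_cst.
Qed.

Lemma power_cvg_tail a x l (r : R) n : (forall n, `|a n| <= 1) ->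
  0 <= r < 1 -> `|x| = r%:C -> power_cvg a x l ->
  `|l - power_sum a x n| <= (r ^+ n / (1 - r))%:C.
Proof.
move=> a1 /andP[r0 r1] xr /cvgrPdist_lt al.
have part k :
    `|power_sum a x (n + k) - power_sum a x n| <= (r ^+ n / (1 - r))%:C.
  rewrite /power_sum (big_cat_nat _ (leq_addr k n)) //= addrAC subrr add0r.
  apply: le_trans (ler_norm_sum _ _ _) _.
  rewrite -[X in index_iota X _]add0n big_addn addKn.
  apply: (@le_trans _ _ (\sum_(0 <= i < k) r ^+ n * r ^+ i)%:C).
    rewrite rmorph_sum; apply: ler_sum => i _.
    rewrite normrM normrX xr -rmorphXn /= normc_def /= expr0n addr0 sqrtr_sqr.
    by rewrite -rmorphM lecR addnC exprD ler_piMl // mulr_ge0 // exprn_ge0.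
  rewrite lecR -mulr_sumr ler_wpM2l ?exprn_ge0 //.
  rewrite -[X in _ <= X]mul1r ler_pdivlMr ?subr_gt0 // big_mkord.
  have : 1 - r ^+ k <= 1 by rewrite gerBl exprn_ge0.
  rewrite -[X in X - _](expr1n _ k) subrXX mulrC.
  by under eq_bigr do rewrite expr1n mul1r.
have [e el] : exists e : R, `|l - power_sum a x n| = e%:C.
  by rewrite normc_def; eexists.
rewrite el lecR; apply/ler_addgt0Pr => d d0.
have [N _ hN] : \forall k \near \oo, `|l - power_sum a x k| < d%:C.
  by apply: al; rewrite ltcR.
rewrite addrC -lecR -el [X in _ <= X]rmorphD.
have -> : l - power_sum a x n = (l - power_sum a x (n + N)) +
   (power_sum a x (n + N) - power_sum a x n) by rewrite addrA subrK.
apply: le_trans (ler_normD _ _) _; rewrite lerD //.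
by apply/ltW/hN; rewrite /= leq_addl.
Qed.

Lemma power_sum_convolution a b x n :
  power_sum (fun n => \sum_(0 <= m < n.+1) a m * b (n - m)%N) x n =
  \sum_(0 <= m < n) (a m)%:C * x ^+ m * power_sum b x (n - m).
Proof.
elim: n => [|n IH]; first by rewrite power_sum0 big_geq.
rewrite power_sumS IH.
have E : \sum_(0 <= m < n) (a m)%:C * x ^+ m * power_sum b x (n - m) =
   \sum_(0 <= m < n.+1) (a m)%:C * x ^+ m * power_sum b x (n - m).
  by rewrite [RHS]big_nat_recr //= subnn power_sum0 mulr0 addr0.
rewrite E rmorph_sum mulr_suml -big_split /= [LHS]big_nat_cond [RHS]big_nat_cond.
apply: eq_bigr => m; rewrite andbT ltnS /= => mn.
rewrite subSn // power_sumS mulrDr; congr (_ + _).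
have -> : x ^+ n = x ^+ m * x ^+ (n - m) by rewrite -exprD subnKC.
by rewrite rmorphM mulrACA.
Qed.

(** Mertens' argument: the partial sum of the product is the sum over m < n of
a_m x^m times a partial sum of b x with n - m terms. Each of the n remainders
contributes at most r^m r^(n-m) / (1 - r), and n r^n tends to 0. *)
Lemma power_cvg_mul a b x A B : (forall n, `|a n| <= 1) ->
  (forall n, `|b n| <= 1) -> `|x| < 1 ->
  power_cvg a x A -> power_cvg b x B ->
  power_cvg (fun n => \sum_(0 <= m < n.+1) a m * b (n - m)%N) x (A * B).
Proof.
move=> a1 b1 /complex_norm_lt1[r rr xr] aA bB.
have /andP[r0 r1] := rr.
have [e Be] : exists e : R, `|B| = e%:C by rewrite normc_def; eexists.
apply: (@complex_cvg_dominated _ _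
    (fun n => (1 - r)^-1 * e * r ^+ n + (1 - r)^-1 * (n%:R * r ^+ n))).
- move=> n; rewrite power_sum_convolution.
  have -> : A * B - \sum_(0 <= m < n) (a m)%:C * x ^+ m * power_sum b x (n - m) =
      (A - power_sum a x n) * B +
      \sum_(0 <= m < n) (a m)%:C * x ^+ m * (B - power_sum b x (n - m)).
    rewrite mulrBl -addrA; congr (_ + _).
    under [X in _ = _ + X]eq_bigr do rewrite mulrBr.
    by rewrite sumrB -mulr_suml addrA addNr sub0r.
  apply: le_trans (ler_normD _ _) _; rewrite [X in _ <= X]rmorphD lerD //.
    rewrite normrM Be [(1 - r)^-1 * e]mulrC -mulrA mulrC.
    rewrite [(1 - r)^-1 * _]mulrC rmorphM.
    apply: ler_pM => //; first by rewrite -Be.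
    exact: power_cvg_tail.
  apply: le_trans (ler_norm_sum _ _ _) _.
  have -> : (1 - r)^-1 * (n%:R * r ^+ n) = \sum_(0 <= m < n) r ^+ n / (1 - r).
    by rewrite sumr_const_nat subn0 -[RHS]mulr_natl mulrC mulrA.
  rewrite rmorph_sum big_nat_cond [X in _ <= X]big_nat_cond; apply: ler_sum => m.
  rewrite andbT /= => mn; rewrite normrM.
  apply: (@le_trans _ _ ((r ^+ m)%:C * (r ^+ (n - m) / (1 - r))%:C)); last first.
    by rewrite -rmorphM mulrA -exprD subnKC // ltnW.
  apply: ler_pM => //; last exact: power_cvg_tail.
  rewrite normrM normrX xr -rmorphXn /= normc_def /= expr0n addr0 sqrtr_sqr.
  by rewrite -rmorphM lecR ler_piMl // exprn_ge0.
- rewrite -[X in _ --> X](addr0 (0 : R)); apply: cvgD.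
    by apply: cvg_geometric; rewrite ger0_norm.
  rewrite -[X in _ --> X](mulr0 (1 - r)^-1).
  apply: cvgM; first exact: cvg_cst.
  exact: cvg_natr_expr.
Qed.

(** The renewal equation holds at every index but 0; this accounts for the
exception. *)
Lemma power_cvg_coef0 a b x l : (forall n, a n.+1 = b n.+1) ->
  power_cvg b x l -> power_cvg a x (l + (a 0%N - b 0%N)%:C).
Proof.
move=> ab bl; rewrite /power_cvg -cvg_shiftS.
have -> : (fun n => power_sum a x n.+1) =
    (fun n => power_sum b x n.+1 + ((a 0%N - b 0%N)%:C : R[i]^o)).
  apply: funext; elim=> [|n IH].
    by rewrite !power_sumS !power_sum0 expr0 !mulr1 !add0r rmorphB addrC subrK.
  by rewrite power_sumS IH [power_sum b x n.+2]power_sumS ab addrAC.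
apply: cvgD; last exact: cvg_cst.
by rewrite (cvg_shiftS (power_sum b x)).
Qed.

(** The difference between the limit and the n-th partial sum is c x^(max k n)
/ (1 - x), for n < k as well. *)
Lemma power_cvg_geometric_tail x (c : R) k : `|x| < 1 ->
  power_cvg (fun n => if (k <= n)%N then c else 0) x (x ^+ k * c%:C / (1 - x)).
Proof.
move=> x1; have [r /andP[r0 r1] xr] := complex_norm_lt1 x x1.
have x1N0 : 1 - x != 0.
  by rewrite subr_eq0; apply: contraTneq x1 => <-; rewrite normr1 ltxx.
have [e eE] : exists e : R, `|c%:C / (1 - x)| = e%:C by rewrite normc_def; eexists.
apply: (complex_cvg_dominated _ _ (fun n => e * r ^+ n)); last first.
  by apply: cvg_geometric; rewrite ger0_norm.
move=> n; have -> : x ^+ k * c%:C / (1 - x) -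
    power_sum (fun n => if (k <= n)%N then c else 0) x n =
    c%:C / (1 - x) * x ^+ maxn k n.
  elim: n => [|n IH]; first by rewrite power_sum0 subr0 maxn0 [RHS]mulrC mulrA.
  rewrite power_sumS opprD addrA IH; case: leqP => kn.
    rewrite (maxn_idPr (leqW kn)) exprS.
    rewrite !mulrA -mulrBl; congr (_ * _).
    by rewrite -{2}[c%:C](divfK x1N0) mulrBr mulr1 subKr.
  by rewrite mul0r subr0 (maxn_idPl kn).
rewrite normrM eE normrX xr -rmorphXn -rmorphM lecR.
apply: ler_wpM2l; first by rewrite -ler0c -eE.
by apply: ler_wiXn2l; rewrite ?leq_maxr // ltW.
Qed.

End power_series.

(** * Words *)

Fixpoint words n : seq word :=
  if n is m.+1 then map (cons false) (words m) ++ map (cons true) (words m)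
  else [:: [::]].

Lemma mem_words n h : (h \in words n) = (size h == n).
Proof.
elim: n h => [|n IH] h /=; first by rewrite inE size_eq0.
rewrite mem_cat; case: h => [|a h].
  by apply/negbTE/norP; split; apply/negP => /mapP[].
by case: a; rewrite eqSS -IH ?mem_map; [|by move=> ? ? []| |by move=> ? ? []];
  rewrite ?orbF; [apply: orb_idl|apply: orb_idr] => /mapP[? _].
Qed.

Lemma words_uniq n : uniq (words n).
Proof.
elim: n => //= n IH; rewrite cat_uniq !map_inj_uniq ?IH ?andbT //=;
  try by move=> ? ? [].
by apply/hasPn => _ /mapP[h _ ->]; apply/negP => /mapP[].
Qed.

Lemma sum_words_cat (V : nmodType) m n (F : word -> V) :
  \sum_(h <- words (m + n)) F h =
  \sum_(h <- words m) \sum_(y <- words n) F (h ++ y).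
Proof.
elim: m F => [|m IH] F; first by rewrite big_seq1.
by rewrite /= !big_cat /= !big_map !IH.
Qed.

Lemma sum_words1 (V : nmodType) n w (F : word -> V) : size w = n ->
  \sum_(h <- words n | h == w) F h = F w.
Proof.
move=> wn; rewrite -big_filter (perm_big [:: w]) ?big_seq1 //=.
apply: uniq_perm => //; first exact/filter_uniq/words_uniq.
move=> h; rewrite mem_filter mem_words inE.
by case: eqP => [->|]; rewrite ?wn ?eqxx.
Qed.

Lemma suffix_size_cat (w s h : word) : (size w <= size h)%N ->
  suffix w (s ++ h) = suffix w h.
Proof.
move=> wh; apply/suffixP/suffixP => -[t e].
  have -> : h = drop (size s) (t ++ w) by rewrite -e drop_size_cat.
  have sw : (size s <= size t)%N.
    have /(congr1 size) := e; rewrite !size_cat => e'.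
    by rewrite -(leq_add2r (size w)) -e' leq_add2l.
  exists (drop (size s) t); rewrite drop_cat; case: ltnP => // ts.
  have -> : size s = size t by apply/eqP; rewrite eqn_leq sw.
  by rewrite subnn drop0 drop_size.
by exists (s ++ t); rewrite -catA e.
Qed.

Lemma suffix_cat_trans (w b h y : word) : suffix w (b ++ h) ->
  suffix w (b ++ h ++ y) = suffix w (w ++ y).
Proof.
case/suffixP => s e; rewrite catA e -catA suffix_size_cat //.
by rewrite size_cat leq_addr.
Qed.

(** * Counting occurrences in a word *)

Section occurrences.
Variable w : word.

(** The word b is the past, h the new letters: an occurrence of w is counted
when its last letter lies in h, even if it starts in b. *)
Definition occ_count b h :=
  count (fun i => suffix w (b ++ take i h)) (iota 1 (size h)).

Definition occ_at b r h := suffix w (b ++ h) && (occ_count b h == r).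

(** When b ++ h ends with w, replacing the past b ++ h by w alone changes no
later occurrence. *)
Lemma occ_count_cat b h y : suffix w (b ++ h) ->
  occ_count b (h ++ y) = (occ_count b h + occ_count w y)%N.
Proof.
move=> wbh; rewrite /occ_count size_cat iotaD count_cat; congr (_ + _)%N.
  apply: eq_in_count => i; rewrite mem_iota add1n ltnS => /andP[_ ih].
  by rewrite takel_cat.
rewrite add1n -addn1 iotaDl count_map; apply: eq_in_count => i _ /=.
by rewrite take_cat ltnNge leq_addr /= addKn suffix_cat_trans.
Qed.

Lemma occ_count_rcons b h a :
  occ_count b (rcons h a) = (occ_count b h + suffix w (b ++ rcons h a))%N.
Proof.
rewrite /occ_count size_rcons -[(size h).+1]addn1 iotaD count_cat /= addn0.
rewrite add1n take_oversize ?size_rcons //; congr (_ + _)%N.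
apply: eq_in_count => i; rewrite mem_iota add1n ltnS => /andP[_ ih].
by rewrite -cats1 takel_cat.
Qed.

Lemma occ_count_gt0 b h : h != [::] -> suffix w (b ++ h) ->
  (0 < occ_count b h)%N.
Proof.
by case/lastP: h => // h a _ hw; rewrite occ_count_rcons hw addn1.
Qed.

(** The r-th occurrence has exactly one position, provided that it exists: the
left-hand side counts these positions. *)
Lemma sum_occ_at b r h : (0 < r)%N ->
  (\sum_(0 <= m < (size h).+1) occ_at b r (take m h))%N =
  (r <= occ_count b h)%N.
Proof.
move=> r0; elim/last_ind: h => [|h a IH].
  rewrite big_nat1 /occ_at /occ_count /=.
  by case: r r0 => //= r _; rewrite andbF.
rewrite size_rcons big_nat_recr //= take_oversize ?size_rcons //.
rewrite (_ : \sum_(0 <= _ < _) _ = (r <= occ_count b h))%N; last first.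
  rewrite -IH [LHS]big_nat [RHS]big_nat; apply: eq_bigr => m.
  by rewrite ltnS => /andP[_ mh]; rewrite -cats1 takel_cat.
rewrite /occ_at occ_count_rcons; case: suffix => /=; last by rewrite addn0 addn0.
rewrite addn1 [(r <= _.+1)%N]leq_eqVlt ltnS eq_sym.
by case: eqVneq => [->|_]; rewrite ?ltnn ?addn0.
Qed.

Lemma occ_at_cat b r h y : occ_at b r h ->
  occ_at b r.+1 (h ++ y) = occ_at w 1 y.
Proof.
case/andP => bh /eqP hr; rewrite /occ_at suffix_cat_trans // occ_count_cat //.
by rewrite hr -addn1 eqn_add2l.
Qed.

End occurrences.

(** * Renewal *)

Section renewal.
Context {R : realType}.
Variables (g : word -> bool -> R).
Hypotheses (g_ge0 : forall h a, 0 <= g h a)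
  (g_sum : forall h, g h false + g h true = 1).

(** The probability that the next letters after the past h are those of y,
when [g] gives the law of the next letter. *)
Fixpoint path_prob (h y : word) : R :=
  if y is a :: y' then g h a * path_prob (rcons h a) y' else 1.

(** After z, letters that precede z no longer matter, now or later. *)
Definition renewing z := forall s y a, g (s ++ z ++ y) a = g (z ++ y) a.

Lemma path_prob_ge0 h y : 0 <= path_prob h y.
Proof. by elim: y h => [|a y IH] h //=; rewrite mulr_ge0. Qed.

Lemma path_prob_cat h y1 y2 :
  path_prob h (y1 ++ y2) = path_prob h y1 * path_prob (h ++ y1) y2.
Proof.
elim: y1 h => [|a y IH] h /=; first by rewrite cats0 mul1r.
by rewrite IH mulrA cat_rcons.
Qed.

Lemma path_prob_renewing z h y : renewing z -> suffix z h ->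
  path_prob h y = path_prob z y.
Proof.
move=> zr /suffixP[s ->].
suff gen t : path_prob (s ++ z ++ t) y = path_prob (z ++ t) y.
  by have := gen [::]; rewrite !cats0.
by elim: y t => [|a y IH] t //=; rewrite zr !rcons_cat IH.
Qed.

Lemma sum_path_prob h n : \sum_(y <- words n) path_prob h y = 1.
Proof.
elim: n h => [|n IH] h; first by rewrite big_seq1.
by rewrite /= big_cat /= !big_map /= -!mulr_sumr !IH !mulr1.
Qed.

Variable w : word.
Hypothesis w_renewing : renewing w.

Section weight.
Variables (b : word) (W : word -> R).
Hypothesis W_ge0 : forall h, 0 <= W h.
Hypothesis W_sum : forall n, \sum_(h <- words n) W h = 1.
Hypothesis W_cat : forall h y, suffix w (b ++ h) ->
  W (h ++ y) = W h * path_prob w y.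

Lemma word_mass_norm (Q : pred word) n :
  `|\sum_(h <- words n | Q h) W h| <= 1.
Proof.
rewrite ger0_norm ?sumr_ge0 // -(W_sum n) [leRHS](bigID Q) /=.
by rewrite lerDl sumr_ge0.
Qed.

(** The event Q forces an r-th occurrence of w. When the path is cut at the
position m of that occurrence, its first m letters carry the weight of the
occurrence, and the later ones start afresh from the past w. *)
Lemma convolution (Q Q' : pred word) r n : (0 < r)%N ->
  (forall h, size h = n -> Q h -> (r <= occ_count w b h)%N) ->
  (forall h y, occ_at w b r h -> Q (h ++ y) = Q' y) ->
  \sum_(h <- words n | Q h) W h =
  \sum_(0 <= m < n.+1) (\sum_(h <- words m | occ_at w b r h) W h) *
                       (\sum_(y <- words (n - m) | Q' y) path_prob w y).
Proof.
move=> r0 Qr QQ'.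
have -> : \sum_(h <- words n | Q h) W h = \sum_(h <- words n)
    \sum_(0 <= m < n.+1) (if Q h && occ_at w b r (take m h) then W h else 0).
  rewrite big_mkcond /=; apply: eq_big_seq => h; rewrite mem_words => /eqP hn.
  case: ifPn => [Qh|_]; last by rewrite big1.
  have := sum_occ_at w b r h r0; rewrite hn Qr // => /(congr1 (fun k => W h *+ k)).
  rewrite mulr1n -sumrMnr => /esym E; rewrite [LHS]E.
  apply: eq_bigr => m _ /=.
  by case: (occ_at _ _ _ _).
rewrite exchange_big /= big_nat [RHS]big_nat; apply: eq_bigr => m.
rewrite ltnS => /andP[_ mn]; rewrite -{1}(subnKC mn) sum_words_cat.
rewrite mulr_suml [RHS]big_mkcond /=; apply: eq_big_seq => h.
rewrite mem_words => /eqP hm; case: ifPn => [hr|hr].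
  rewrite mulr_sumr [RHS]big_mkcond /=; apply: eq_bigr => y _.
  rewrite take_size_cat // hr andbT QQ' // W_cat //.
  by case/andP: hr.
by rewrite big1 // => y _; rewrite take_size_cat // (negbTE hr) andbF.
Qed.

(** For a process with weights W and past b: the probabilities that w occurs
at position n ([visit_mass]), and that its r-th occurrence is there
([hit_mass]). The next two definitions are their counterparts for a path
started after w: the renewal sequence u_n and the law f_n of the first return.
*)
Definition visit_mass n := \sum_(h <- words n | suffix w (b ++ h)) W h.

Definition hit_mass r n := \sum_(h <- words n | occ_at w b r h) W h.

Definition renewal_mass n :=
  \sum_(y <- words n | suffix w (w ++ y)) path_prob w y.

Definition return_mass n := \sum_(y <- words n | occ_at w w 1 y) path_prob w y.

(** Position 0 is excluded when b ends with w: that occurrence belongs to the past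
and [hit_mass] ignores it. *)
Lemma visit_massE n : (n == 0)%N ==> ~~ suffix w b ->
  visit_mass n = \sum_(0 <= m < n.+1) hit_mass 1 m * renewal_mass (n - m).
Proof.
move=> n0; apply: convolution => // [h hn hw|h y /andP[hw _]].
  apply: occ_count_gt0 => //; apply: contraTneq hw => h0.
  by move: n0; rewrite -hn h0 /= cats0.
exact: suffix_cat_trans.
Qed.

Lemma hit_massS r n : (0 < r)%N ->
  hit_mass r.+1 n = \sum_(0 <= m < n.+1) hit_mass r m * return_mass (n - m).
Proof.
move=> r0; apply: convolution => // [h _ /andP[_ /eqP->] //|h y].
exact: occ_at_cat.
Qed.

End weight.

Lemma renewal_mass0 : renewal_mass 0 = 1.
Proof. by rewrite /renewal_mass /= big_mkcond big_seq1 cats0 suffix_refl. Qed.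

Lemma renewal_massE n : (0 < n)%N ->
  renewal_mass n = \sum_(0 <= m < n.+1) return_mass m * renewal_mass (n - m).
Proof.
move=> n0; apply: (@visit_massE w (path_prob w)).
- move=> h y hw; rewrite path_prob_cat; congr (_ * _).
  exact: path_prob_renewing.
- by rewrite gtn_eqF.
Qed.

(** An occurrence of w that ends at least |w| letters after the previous one
does not overlap it. *)
Lemma renewal_mass_long n : (size w <= n)%N ->
  renewal_mass n = \sum_(y <- words n | suffix w y) path_prob w y.
Proof.
move=> wn; rewrite /renewal_mass big_seq_cond [RHS]big_seq_cond.
apply: eq_bigl => y; rewrite mem_words; case: eqP => //= yn.
by rewrite suffix_size_cat // yn.
Qed.

(** At distance n < |w| the two occurrences overlap: w needs a border of
length |w| - n, and then the n new letters are the last n letters of w. *)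
Lemma renewal_mass_short n : (n < size w)%N ->
  renewal_mass n = if drop n w == take (size w - n) w
    then \sum_(y <- words n | suffix (drop (size w - n) w) y) path_prob w y
    else 0.
Proof.
move=> nw.
have E y : size y = n -> suffix w (w ++ y) =
    (drop n w == take (size w - n) w) && suffix (drop (size w - n) w) y.
  move=> yn; rewrite !suffixE size_cat yn addKn drop_cat nw.
  rewrite size_drop subKn ?subnn ?drop0; last exact: ltnW.
  rewrite -{2}(cat_take_drop (size w - n) w) eqseq_cat //.
  by rewrite size_drop size_takel // leq_subr.
rewrite /renewal_mass big_seq_cond; case: ifP => [oE|oF].
  rewrite [RHS]big_seq_cond; apply: eq_bigl => y; rewrite mem_words.
  by case: eqP => //= /E ->; rewrite oE.
apply: big_pred0 => y; rewrite mem_words; case: eqP => //= /E ->.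
by rewrite oF.
Qed.

End renewal.

(** * Sequences and their measurable structure *)

Lemma size_last_letters s n : size (last_letters s n) = n.
Proof. by rewrite size_rev size_mkseq. Qed.

Lemma last_letters_snoc (s : lseq) a n :
  last_letters (snoc s a) n.+1 = rcons (last_letters s n) a.
Proof.
by rewrite /last_letters /mkseq /= rev_cons -[1%N]addn0 iotaDl -map_comp.
Qed.

Lemma last_lettersS (s : nat -> bool) n :
  last_letters s n.+1 = s n :: last_letters s n.
Proof. by rewrite /last_letters mkseqS rev_rcons. Qed.

Lemma cylinder_cons_setU h :
  cylinder h = cylinder (false :: h) `|` cylinder (true :: h).
Proof.
apply/seteqP; split=> s; rewrite /cylinder /= !last_lettersS.
  by move=> ->; case: (s _); [right|left].
by move=> [] [].
Qed.

Lemma measurable_cylinder h : measurable (cylinder h : set lseq).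
Proof. by apply: sub_gen_smallest; exists h. Qed.

Section word_valued.
Context {d} {T : measurableType d} {n : nat} (f : T -> word).
Hypotheses (fn : forall t, size (f t) = n)
  (mf : forall h, measurable [set t | f t = h]).

Lemma word_event_bigU (Q : pred word) :
  [set t | Q (f t)] = \big[setU/set0]_(h <- words n | Q h) [set t | f t = h].
Proof.
rewrite -bigcup_seq_cond; apply/seteqP; split => t /=.
  by move=> Qt; exists (f t) => //=; rewrite Qt mem_words fn eqxx.
by move=> [h /=/andP[_ Qh] ->].
Qed.

Lemma measurable_word_event (Q : pred word) : measurable [set t | Q (f t)].
Proof. by rewrite word_event_bigU; exact: bigsetU_measurable. Qed.

Lemma measure_word_event {R : realType} (P : probability T R) (Q : pred word) :
  P [set t | Q (f t)] = (\sum_(h <- words n | Q h) P [set t | f t = h])%E.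
Proof.
rewrite word_event_bigU; move: (words n) (words_uniq n) => r.
elim: r => [|h r IH]; first by rewrite !big_nil measure0.
move=> /= /andP[hr /IH{}IH]; rewrite !big_cons; case: ifP => // _.
rewrite measureU //; [by congr adde; exact: IH|exact: bigsetU_measurable|].
rewrite -bigcup_seq_cond -subset0 => t [/= th [h' /=/andP[h'r _] th']].
by move: hr; rewrite -th th' h'r.
Qed.

End word_valued.

Lemma measurable_mkseq d (T : measurableType d) (f : nat -> T -> bool) n h :
  (forall i b, measurable [set t | f i t = b]) ->
  measurable [set t | mkseq (f^~ t) n = h].
Proof.
move=> mf; elim: n h => [|n IH] h.
  case: h => [|b h].
    by rewrite [X in measurable X](_ : _ = setT) //; apply/seteqP; split.
  by rewrite [X in measurable X](_ : _ = set0) //; apply/seteqP; split.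
under eq_set do rewrite mkseqS.
case/lastP: h => [|h b].
  rewrite [X in measurable X](_ : _ = set0) //; apply/seteqP; split => // t.
  by move=> /(congr1 size); rewrite size_rcons.
rewrite [X in measurable X](_ : _ =
    [set t | mkseq (f^~ t) n = h] `&` [set t | f n t = b]).
  exact: measurableI.
apply/seteqP; split => t /=.
  by move=> /eqP; rewrite eqseq_rcons => /andP[/eqP-> /eqP->].
by move=> [-> ->].
Qed.

Lemma measurable_coordinate i b : measurable [set s : lseq | s i = b].
Proof.
rewrite (_ : mkset _ = [set s : lseq | head false (last_letters s i.+1) == b]).
  apply: (@measurable_word_event _ lseq i.+1 (last_letters ^~ i.+1) _ _
    (fun h => head false h == b)) => [s|h]; first exact: size_last_letters.
  have [hi|hi] := eqVneq (size h) i.+1.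
    by rewrite -hi; exact: measurable_cylinder.
  rewrite [X in measurable X](_ : _ = set0) //; apply/seteqP; split => // s /= e.
  by move: hi; rewrite -e size_last_letters eqxx.
by apply/seteqP; split => s /=; rewrite last_lettersS /= => /eqP.
Qed.

Lemma measurable_snoc a : measurable_fun setT (snoc ^~ a : lseq -> lseq).
Proof.
apply: (@measurability _ _ lseq lseq setT _ (range cylinder)) => //.
move=> _ [_ [h _ <-] <-].
rewrite setTI; case/lastP: h => [|h b].
  by rewrite [X in measurable X](_ : _ = setT) //; apply/seteqP; split.
rewrite [X in measurable X](_ : _ = if b == a then cylinder h else set0).
  by case: ifP => // _; exact: measurable_cylinder.
apply/seteqP; split => s; rewrite /cylinder /= size_rcons last_letters_snoc.
  by move=> /eqP; rewrite eqseq_rcons => /andP[/eqP sh /eqP->]; rewrite eqxx.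
by case: eqP => //= -> ->.
Qed.

Lemma measurable_context_of c : measurable [set s : lseq | context_of s c].
Proof.
case cu : (context_word c) => [u|].
  rewrite [X in measurable X](_ : _ = cylinder (rev u)).
    exact: measurable_cylinder.
  rewrite /context_of cu /cylinder /last_letters size_rev.
  by apply/seteqP; split => s /= => [->|/(can_inj revK)].
rewrite [X in measurable X](_ : _ = \bigcap_i [set s : lseq | s i = odd i]).
  by apply: bigcapT_measurable => i; exact: measurable_coordinate.
rewrite /context_of cu; apply/seteqP; split => s /= h i; first by move=> _.
exact: h.
Qed.

Lemma countable_context : countable [set: context].
Proof.
apply/countable_injP; exists (fun c => match c with
  | ctx1 n => n.*2.+1 | ctx00 n => n.*2.+2 | ctx_inf => 0%N end).
move=> [m|m|] [n|n|] _ _ //= [].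
- by move/double_inj->.
- by move/(congr1 odd); rewrite /= !odd_double.
- by move/(congr1 odd); rewrite /= !odd_double.
- by move/double_inj->.
Qed.

Lemma measurable_pref (A : set context) :
  measurable [set s : lseq | A (pref s)].
Proof.
rewrite [X in measurable X](_ : _ =
    \bigcup_c [set s : lseq | context_of s c /\ A c]).
  apply: countable_bigcupT_measurable; first exact: countable_context.
  move=> c; have [Ac|Ac] := pselect (A c).
    rewrite [X in measurable X](_ : _ = [set s : lseq | context_of s c]).
      exact: measurable_context_of.
    by apply/seteqP; split => s /= => [[]|].
  rewrite [X in measurable X](_ : _ = set0) //.
  by apply/seteqP; split => s //= -[].
apply/seteqP; split => s /=.
  by move=> As; exists (pref s) => //; split=> //; exact: prefP.
by move=> [c _ [/prefE -> ]].
Qed.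

Lemma cylinder_nth h s i : cylinder h s -> (i < size h)%N ->
  s i = nth false (rev h) i.
Proof.
move=> <- ih; rewrite size_last_letters in ih.
by rewrite /last_letters revK nth_mkseq.
Qed.

Definition has_double (h : word) := exists s b t, h = s ++ [:: b; b] ++ t.

Lemma has_double_cat s h t : has_double h -> has_double (s ++ h ++ t).
Proof.
by move=> [s' [b [t' ->]]]; exists (s ++ s'), b, (t' ++ t); rewrite -!catA.
Qed.

(** A context is read backwards along an alternating word until the first
fault. Two equal neighbouring letters cannot both agree with that word, so the
fault lies in h. *)
Lemma pref_has_double h (s1 s2 : lseq) : has_double h ->
  cylinder h s1 -> cylinder h s2 -> pref s1 = pref s2.
Proof.
move=> [s [b [t hE]]] h1 h2.
have eq12 i : (i < size h)%N -> s1 i = s2 i.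
  by move=> ih; rewrite (cylinder_nth h s1) // (cylinder_nth h s2).
have nh : ((size t).+1 < size h)%N.
  by rewrite hE !size_cat /=; exact: leq_addl.
have dbl : s1 (size t) = s1 (size t).+1.
  rewrite !(cylinder_nth h s1) //; last exact: ltnW.
  rewrite hE !rev_cat !nth_cat !size_cat !size_rev /= addn2 !ltnS leqnn leqnSn.
  by rewrite ltnn subnn ltnNge leqnSn subSnn.
(* An alternating prefix stops before the double letter, hence inside h. *)
have short n : (forall i, (i < n)%N -> s1 i = odd i) -> (n < size h)%N.
  move=> alt; rewrite ltnNge; apply/negP => hn.
  have := dbl; rewrite !alt /=; last by apply: leq_trans hn; exact: ltnW.
    by case: odd.
  exact: leq_trans hn.
apply/esym/prefE; have := prefP s1; case: (pref s1) => [n|n|]; rewrite !context_ofE.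
- move=> [alt e]; have nlt := short _ alt; split; last by rewrite -eq12.
  by move=> i ilt; rewrite -eq12 ?alt //; exact: ltn_trans nlt.
- move=> [alt e]; have nlt := short _ alt; split; last by rewrite -eq12.
  by move=> i ilt; rewrite -eq12 ?alt //; exact: ltn_trans nlt.
- by move=> alt; have := short (size h) (fun i _ => alt i); rewrite ltnn.
Qed.

(** The padding with 0 is immaterial for the words that contain a double
letter, whose context does not depend on the remote past. *)
Definition extend (h : word) : lseq := nth false (rev h).

Lemma cylinder_extend s h : cylinder h (extend (s ++ h)).
Proof.
rewrite /cylinder /=; apply: (can_inj revK); rewrite revK.
apply: (@eq_from_nth _ false); rewrite size_mkseq ?size_rev // => i ih.
by rewrite nth_mkseq // /extend rev_cat nth_cat size_rev ih.
Qed.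

Section stationary.
Context {R : realType}.
Variables (q : context -> probability bool R) (pi : probability lseq R).

Definition next_prob (h : word) (a : bool) : R :=
  fine (q (pref (extend h)) [set a]).

Lemma next_prob_ge0 h a : 0 <= next_prob h a.
Proof. by rewrite fine_ge0. Qed.

Lemma context_prob_sum c : (\sum_(a : bool) q c [set a] = 1)%E.
Proof.
rewrite big_bool /= -measureU //; last first.
  by apply/seteqP; split => // a [/= ->].
rewrite -[RHS](probability_setT (q c)); congr (q c _).
by apply/seteqP; split => // -[]; [left|right].
Qed.

Lemma next_prob_sum h : next_prob h false + next_prob h true = 1.
Proof.
have := context_prob_sum (pref (extend h)).
rewrite big_bool => E; rewrite addrC /next_prob -fineD ?fin_num_measure //.
exact: (congr1 fine E).
Qed.

Lemma next_probE h a (s : lseq) : has_double h -> cylinder h s ->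
  q (pref s) [set a] = (next_prob h a)%:E.
Proof.
move=> hd hs; rewrite fineK ?fin_num_measure //.
by rewrite (pref_has_double h s (extend h)) //; exact: (cylinder_extend [::]).
Qed.

Lemma has_double_renewing z : has_double z -> renewing next_prob z.
Proof.
move=> zd s y a; rewrite /next_prob.
rewrite (pref_has_double (z ++ y) _ (extend (z ++ y))) //.
- exact: (has_double_cat [::]).
- exact: cylinder_extend.
- exact: (cylinder_extend [::]).
Qed.

(** The function takes countably many values, one for each context. *)
Lemma measurable_next a :
  measurable_fun setT ((fun s => q (pref s) [set a]) : lseq -> \bar R).
Proof.
move=> _ Y _; rewrite setTI.
exact: (measurable_pref [set c | Y (q c [set a])]).
Qed.

Definition word_prob h : R := fine (pi (cylinder h)).

Lemma word_probE h : pi (cylinder h) = (word_prob h)%:E.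
Proof. by rewrite fineK // fin_num_measure //; exact: measurable_cylinder. Qed.

Lemma word_prob_ge0 h : 0 <= word_prob h.
Proof. by rewrite fine_ge0. Qed.

Lemma word_prob_nil : word_prob [::] = 1.
Proof.
rewrite /word_prob (_ : cylinder _ = setT) ?probability_setT //.
by apply/seteqP; split.
Qed.

Lemma word_prob_cons h :
  word_prob h = word_prob (false :: h) + word_prob (true :: h).
Proof.
rewrite /word_prob [in LHS]cylinder_cons_setU.
rewrite measureU; [|exact: measurable_cylinder..|].
  by rewrite fineD // fin_num_measure //; exact: measurable_cylinder.
by apply/seteqP; split => // s [h1 h2]; have := etrans (esym h1) h2.
Qed.

Lemma sum_word_prob_cat n h :
  \sum_(s <- words n) word_prob (s ++ h) = word_prob h.
Proof.
elim: n => [|n IH]; first by rewrite big_seq1.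
rewrite /= big_cat /= !big_map -big_split /= -[RHS]IH.
by apply: eq_bigr => s _; rewrite -word_prob_cons.
Qed.

Lemma sum_word_prob n : \sum_(s <- words n) word_prob s = 1.
Proof.
rewrite -word_prob_nil -[RHS](sum_word_prob_cat n).
by apply: eq_bigr => s _; rewrite cats0.
Qed.

Hypothesis hpi : stationary_distribution q pi.

(** Stationarity applied to the cylinder of [rcons h a]: the previous state
must lie in the cylinder of h, on which the transition probability is
constant. *)
Lemma word_prob_rcons h a : has_double h ->
  word_prob (rcons h a) = word_prob h * next_prob h a.
Proof.
move=> hd; apply: EFin_inj; rewrite -word_probE hpi; last first.
  exact: measurable_cylinder.
transitivity (\int[pi]_s ((next_prob h a)%:E * (\1_(cylinder h) s)%:E))%E.
  apply: eq_integral => s _.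
  have E b : (\d_(snoc s b) (cylinder (rcons h a)) =
      ((b == a) && (s \in cylinder h))%:R%:E :> \bar R)%E.
    rewrite diracE; congr (_%:R%:E); congr nat_of_bool; apply/idP/andP.
      rewrite inE /cylinder /= size_rcons last_letters_snoc => /eqP.
      by rewrite eqseq_rcons => /andP[/eqP sh ->]; split => //; rewrite inE.
    rewrite !inE /cylinder /= size_rcons last_letters_snoc.
    by move=> [/eqP-> ->].
  rewrite (bigD1 a) //= big1 ?adde0 => [|b /negbTE ba]; last by rewrite E ba mule0.
  rewrite E eqxx /= indicE; case: (boolP (s \in _)) => [|_]; last by rewrite !mule0.
  by rewrite inE => sh; rewrite (next_probE h).
rewrite ge0_integralZl_EFin ?next_prob_ge0 //.
  rewrite integral_indic //; last exact: measurable_cylinder.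
  by rewrite setIT EFinM muleC -word_probE.
by apply/measurable_EFinP; apply: measurable_indic; exact: measurable_cylinder.
Qed.

Lemma word_prob_cat h y : has_double h ->
  word_prob (h ++ y) = word_prob h * path_prob next_prob h y.
Proof.
elim: y h => [|a y IH] h hd /=; first by rewrite cats0 mulr1.
rewrite -cat_rcons IH ?word_prob_rcons ?mulrA // -cats1.
exact: (has_double_cat [::]).
Qed.

End stationary.

(** * From the chain to finite words *)

Section chain.
Context {R : realType} {d : measure_display} {T : measurableType d}
  {P : probability T R}.
Variables (q : context -> probability bool R) (pi : probability lseq R).
Variable (U : nat -> {RV P >-> lseq}).

Definition step n a : set T := [set t | U n.+1 t = snoc (U n t) a].

Lemma measurable_state n (B : set lseq) : measurable B -> measurable (U n @^-1` B).
Proof. by move=> mB; rewrite -[X in measurable X]setTI; exact: measurable_funP. Qed.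

Lemma measurable_state_coordinate n i b : measurable [set t | U n t i = b].
Proof. exact: (measurable_state n _ (measurable_coordinate i b)). Qed.

Lemma measurable_step n a : measurable (step n a).
Proof.
rewrite [X in measurable X](_ : _ =
    \bigcap_i [set t | U n.+1 t i = snoc (U n t) a i]).
  apply: bigcapT_measurable => -[|i] /=; first exact: measurable_state_coordinate.
  rewrite [X in measurable X](_ : _ =
      ([set t | U n.+1 t i.+1 = false] `&` [set t | U n t i = false]) `|`
      ([set t | U n.+1 t i.+1 = true] `&` [set t | U n t i = true])).
    by apply: measurableU; apply: measurableI; exact: measurable_state_coordinate.
  apply/seteqP; split => t /= => [->|[] [-> ->] //].
  by case: (U n t i); [right|left].
apply/seteqP; split => t /=; first by rewrite /step /= => e i _ /=; rewrite e.
by move=> h; apply: funext => i; exact: h.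
Qed.

Hypothesis hU : VLMC q U.

(** Only one letter can be appended at a time, so the two events are disjoint;
each of them is evaluated by the transition rule. *)
Lemma step_prob n (B : bool -> set lseq) : (forall a, measurable (B a)) ->
  P (U n @^-1` B false `&` step n false `|` U n @^-1` B true `&` step n true) =
  (\int[P]_t \sum_(a : bool) q (pref (U n t)) [set a] * (\1_(B a) (U n t))%:E)%E.
Proof.
move=> mB.
have mf a : measurable_fun setT
    ((fun t => q (pref (U n t)) [set a] * (\1_(B a) (U n t))%:E)%E : T -> \bar R).
  apply: emeasurable_funM.
    apply: (@measurableT_comp _ _ _ _ _ _
      (fun s : lseq => q (pref s) [set a] : \bar R)) => //.
    exact: measurable_next.
  apply/measurable_EFinP.
  exact: (@measurableT_comp _ _ _ _ _ _ (\1_(B a) : lseq -> R)).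
have one a : P (U n @^-1` B a `&` step n a) =
    (\int[P]_t (q (pref (U n t)) [set a] * (\1_(B a) (U n t))%:E))%E.
  rewrite /step hU; last first.
    by apply: sub_gen_smallest; exists n => //=; exists (B a) => //; rewrite setTI.
  rewrite integral_mkcond; apply: eq_integral => t _.
  rewrite /patch indicE -[t \in _]/(U n t \in B a).
  by case: ifP => _; rewrite ?mule1 ?mule0.
rewrite ge0_integral_sum //; last by move=> a t _; rewrite mule_ge0 // lee_fin.
rewrite big_bool /= addrC measureU.
- exact: (congr2 adde (one false) (one true)).
- by apply: measurableI; [exact: measurable_state|exact: measurable_step].
- by apply: measurableI; [exact: measurable_state|exact: measurable_step].
- apply/seteqP; split => // t [[_ h1] [_ h2]].
  by have := congr1 (fun s : nat -> bool => s 0%N) (etrans (esym h1) h2).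
Qed.

(** The transition rule is stated for each appended letter separately. That a
letter is almost surely appended follows since the q_c have total mass 1. *)
Lemma almost_step n : P (~` (step n false `|` step n true)) = 0%E.
Proof.
rewrite probability_setC; last by apply: measurableU; exact: measurable_step.
have := step_prob n (fun=> setT) (fun=> measurableT).
rewrite !preimage_setT !setTI => ->.
rewrite (eq_integral (cst 1%E)).
  rewrite integral_cst // mul1e; transitivity (1 - 1 : \bar R)%E; last exact: subee.
  congr (1 - _)%E; exact: probability_setT.
move=> t _; rewrite -(context_prob_sum q (pref (U n t))); apply: eq_bigr => a _.
by rewrite indicT mule1.
Qed.

Lemma eq_prob_off_null (A B N : set T) :
  measurable A -> measurable B -> measurable N ->
  P N = 0%E -> (forall t, ~ N t -> A t <-> B t) -> P A = P B.
Proof.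
move=> mA mB mN N0 AB.
have D C : measurable C -> P C = P (C `\` N).
  move=> mC; have CN0 : P (C `&` N) = 0%E.
    by apply: subset_measure0 N0 => //; exact: measurableI.
  apply: etrans (measureDI P mC mN) _; rewrite -[RHS]adde0 -CN0; reflexivity.
rewrite (D _ mA) (D _ mB); congr (P _); apply/seteqP.
by split => t [h nN]; split => //; apply/AB.
Qed.

(** The null event off which every state is an extension of all the previous
ones. *)
Definition jump : set T := \bigcup_n ~` (step n false `|` step n true).

Lemma measurable_jump : measurable jump.
Proof.
apply: bigcupT_measurable => n; apply: measurableC; apply: measurableU;
  exact: measurable_step.
Qed.

Lemma jump0 : P jump = 0%E.
Proof.
apply/negligibleP; first exact: measurable_jump.
apply: negligible_bigcup => n; apply/negligibleP; last exact: almost_step.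
by apply: measurableC; apply: measurableU; exact: measurable_step.
Qed.

(** Off the null event, the letters of one state are those of the process,
negative indices included. *)
Lemma letter_state t n j : ~ jump t -> letter U (n%:Z - j%:Z) t = U n t j.
Proof.
move=> nj; elim: n j => [|n IH] [|j].
- by [].
- by rewrite sub0r -NegzE.
- by rewrite subr0.
have -> : n.+1%:Z - j.+1%:Z = n%:Z - j%:Z.
  by rewrite !intS opprD addrACA subrr add0r.
rewrite IH; have : (step n false `|` step n true) t.
  by apply: contrapT => h; apply: nj; exists n.
by case=> ->.
Qed.

Lemma block_state t n k : ~ jump t -> block U n k t = last_letters (U n t) k.
Proof.
move=> nj; apply: (@eq_from_nth _ false); rewrite size_mkseq ?size_last_letters //.
move=> i ik; rewrite nth_mkseq // nth_rev ?size_mkseq // nth_mkseq; last first.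
  by rewrite ltn_subrL (leq_ltn_trans _ ik).
rewrite -letter_state //; congr (letter U _ t).
rewrite -[LHS]addrA; congr (_ + _).
by rewrite -subzn // opprB addrC.
Qed.

Lemma measurable_letter m b : measurable [set t | letter U m t = b].
Proof. by case: m => n; exact: measurable_state_coordinate. Qed.

Lemma measurable_block n k h : measurable [set t | block U n k t = h].
Proof.
apply: (measurable_mkseq _ _ (fun i => letter U (n%:Z - k%:Z + i.+1%:Z))) => i b.
exact: measurable_letter.
Qed.

Hypothesis hpi : stationary_distribution q pi.
Hypothesis hU0 : forall B : set lseq, measurable B -> P (U 0%N @^-1` B) = pi B.

(** Appending a letter preserves pi: the integral over U_n of the transition
probabilities is the one that defines a stationary distribution. *)
Lemma state_law n (B : set lseq) : measurable B -> P (U n @^-1` B) = pi B.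
Proof.
elim: n B => [|n IH] B mB; first exact: hU0.
pose Bs a : set lseq := [set s | B (snoc s a)].
have mBs a : measurable (Bs a).
  by rewrite -[X in measurable X]setTI; exact: measurable_snoc.
have mS a : measurable (U n @^-1` Bs a `&` step n a).
  by apply: measurableI; [exact: measurable_state|exact: measurable_step].
rewrite (eq_prob_off_null _ (U n @^-1` Bs false `&` step n false `|`
                      U n @^-1` Bs true `&` step n true) jump) //.
- rewrite step_prob // hpi //.
  pose f (s : lseq) :=
    (\sum_(a : bool) q (pref s) [set a] * (\1_(Bs a) s)%:E : \bar R)%E.
  have mf : measurable_fun setT f.
    apply: emeasurable_sum => a.
    apply: emeasurable_funM; first exact: measurable_next.
    by apply/measurable_EFinP; apply: measurable_indic.
  have f0 s : (0 <= f s)%E by apply: sume_ge0 => a _; rewrite mule_ge0 // lee_fin.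
  transitivity (\int[pushforward P (U n)]_s f s)%E.
    by rewrite ge0_integral_pushforward //.
  rewrite (@eq_measure_integral _ _ _ _ pi) //.
  by move=> A mA _; exact: IH.
- exact: measurable_state.
- exact: measurableU.
- exact: measurable_jump.
- exact: jump0.
move=> t nj; split => [Bt|].
  have : (step n false `|` step n true) t.
    by apply: contrapT => h; apply: nj; exists n.
  by case=> st; [left|right]; split => //; rewrite /Bs /= -st.
by case=> -[/= h st]; rewrite st.
Qed.

Lemma block_law n h : P [set t | block U n (size h) t = h] = (word_prob pi h)%:E.
Proof.
rewrite -word_probE -(state_law n); last exact: measurable_cylinder.
apply: (eq_prob_off_null _ _ jump);
  [exact: measurable_block| |exact: measurable_jump|exact: jump0|].
  by apply: measurable_state; exact: measurable_cylinder.
by move=> t nj; rewrite /= block_state.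
Qed.

(** Every event used later depends on finitely many letters; this turns its
probability into a finite sum. *)
Lemma block_event_law n k (Q : pred word) :
  P [set t | Q (block U n k t)] = (\sum_(h <- words k | Q h) word_prob pi h)%:E.
Proof.
rewrite (@measure_word_event _ _ k (fun t => block U n k t) _ _ _ P Q) => [|t|h].
- rewrite -sumEFin big_seq_cond [RHS]big_seq_cond; apply: eq_bigr => h.
  by rewrite mem_words => /andP[/eqP <- _]; exact: block_law.
- exact: size_mkseq.
- exact: measurable_block.
Qed.

End chain.

(** * The conditioning words *)

Lemma rev_word_pow01 l : rev (word_pow w01 l) = word_pow w10 l.
Proof.
rewrite /word_pow; elim: l => //= l IH.
rewrite !rev_cons IH -!cats1 -catA /=.
by elim: {IH} l => //= l ->.
Qed.

Lemma rev_word_pow10 l : rev (word_pow w10 l) = word_pow w01 l.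
Proof. by rewrite -rev_word_pow01 revK. Qed.

Lemma word_pow01_rcons l :
  true :: word_pow w01 l ++ [:: false] = word_pow w10 l.+1.
Proof. by rewrite /word_pow; elim: l => //= l IH; rewrite IH. Qed.

(** The reversed v consists of the double letter displayed in w and of all the
letters that follow it. *)
Lemma conditioning_word (w v : word) :
  ((exists (s : word) (l : nat),
         w = s ++ w00 ++ word_pow w10 l \/
         w = s ++ w11 ++ word_pow w01 l ++ [:: false]) /\
       v = pref_word w) \/
    (exists (s : word) (l : nat),
       w = s ++ w00 ++ word_pow w10 l ++ [:: true] /\
       v = [:: true] ++ word_pow w01 l ++ w00) \/
    (exists (s : word) (l : nat),
       w = s ++ w11 ++ word_pow w01 l /\
       v = word_pow w10 l ++ w11) ->
  suffix (rev v) w /\ has_double (rev v).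
Proof.
have dbl b t : has_double ([:: b; b] ++ t) by exists [::], b, t.
case=> [[[s [l [wE|wE]]] ->]|[[s [l [-> ->]]]|[s [l [-> ->]]]]].
- have revE : rev (word_pow w01 l ++ w00) = w00 ++ word_pow w10 l.
    by rewrite rev_cat rev_word_pow01.
  have sw : suffix (rev (word_pow w01 l ++ w00)) w.
    by rewrite revE wE suffix_suffix.
  rewrite (pref_wordE (u := word_pow w01 l ++ w00)) //; last by exists (ctx00 l).
  by split=> //; rewrite revE.
- have revE : rev (word_pow w01 l.+1 ++ [:: true]) =
      w11 ++ word_pow w01 l ++ [:: false].
    by rewrite rev_cat rev_word_pow01 -word_pow01_rcons.
  have sw : suffix (rev (word_pow w01 l.+1 ++ [:: true])) w.
    by rewrite revE wE suffix_suffix.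
  rewrite (pref_wordE (u := word_pow w01 l.+1 ++ [:: true])) //; last first.
    by exists (ctx1 l.+1).
  by split=> //; rewrite revE.
- have -> : rev ([:: true] ++ word_pow w01 l ++ w00) =
      w00 ++ word_pow w10 l ++ [:: true].
    by rewrite !rev_cat rev_word_pow01 -catA.
  by rewrite suffix_suffix.
- have -> : rev (word_pow w10 l ++ w11) = w11 ++ word_pow w01 l.
    by rewrite rev_cat rev_word_pow10.
  by rewrite suffix_suffix.
Qed.

Section occurrence_times.
Context {R : realType} {d : measure_display} {T : measurableType d}
  {P : probability T R}.
Variables (q : context -> probability bool R) (pi : probability lseq R).
Variable (U : nat -> {RV P >-> lseq}).

Lemma size_block n k t : size (block U n k t) = k.
Proof. exact: size_mkseq. Qed.

Lemma drop_block n k m t : drop m (block U n (m + k) t) = block U n k t.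
Proof.
apply: (@eq_from_nth _ false); rewrite size_drop !size_block addKn // => i ik.
rewrite nth_drop /block !nth_mkseq ?ltn_add2l //; congr (letter U _ t).
by rewrite -addnS !PoszD [m%:Z + k%:Z]addrC opprD !addrA subrK.
Qed.

Lemma take_block n k m t : take k (block U (n + m) (k + m) t) = block U n k t.
Proof.
apply: (@eq_from_nth _ false); rewrite size_takel ?size_block ?leq_addr // => i ik.
rewrite nth_take // /block !nth_mkseq ?(leq_trans ik) ?leq_addr //.
congr (letter U _ t).
by rewrite !PoszD opprD addrACA subrr addr0.
Qed.

Lemma suffix_block (u : word) n k t : (size u <= k)%N ->
  suffix u (block U n k t) = (block U n (size u) t == u).
Proof.
move=> uk; rewrite suffixE size_block -{2}(subnK uk).
by rewrite drop_block.
Qed.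

Variable w : word.
Hypothesis w_neq0 : w != [::].

Lemma occursE t i : occurs U w t i = suffix w (block U i i t).
Proof.
rewrite /occurs; case: leqP => [wi|iw] /=; first by rewrite suffix_block.
by apply/esym/negbTE; apply: contraL iw => /size_suffix; rewrite size_block -leqNgt.
Qed.

Lemma count_occurs t n :
  count (occurs U w t) (iota 0 n.+1) = occ_count w [::] (block U n n t).
Proof.
rewrite /= occursE suffixs0 (negbTE w_neq0) add0n /occ_count size_block.
apply: eq_in_count => i; rewrite mem_iota add1n ltnS => /andP[_ ilen].
by rewrite occursE /= -[in take i _](subnKC ilen) take_block.
Qed.

(** The position n is unique, because the number of occurrences increases at
each of them. *)
Lemma occ_timeE r n t : (0 < r)%N ->
  occ_time U w r t = Some n <-> occ_at w [::] r (block U n n t).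
Proof.
move=> r0; set A := [set Some n | n in [set n | occurs U w t n /\
  count (occurs U w t) (iota 0 n.+1) = r]].
have AE m : A (Some m) <-> occ_at w [::] r (block U m m t).
  rewrite /occ_at -count_occurs -occursE; split.
    by move=> [m' [om cm] [<-]]; rewrite om cm eqxx.
  by move=> /andP[h1 /eqP h2]; exists m.
have uniq_time m m' : A (Some m) -> A (Some m') -> ~ (m < m')%N.
  move=> [k [_ cm] [<-]] [k' [om' cm'] [<-]] kk'.
  move: cm'; rewrite -(subnKC (ltnW kk')) -addSn iotaD count_cat cm.
  rewrite -[r in RHS]addn0.
  move/addnI/eqP; rewrite -leqn0 leqNgt -has_count; apply/negP/negPn/hasP.
  by exists k' => //; rewrite mem_iota add0n kk' /= addSn ltnS subnKC // ltnW.
rewrite -AE /occ_time -/A; split => [tn|An].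
  have [[a Aa]|nA] := pselect (exists a, A a).
    by rewrite -tn; apply: xgetPex; exists a.
  by move: tn; rewrite xgetPN // => a Aa; apply: nA; exists a.
have AX : A (xget None A) by apply: xgetPex; exists (Some n).
case: (xget None A) AX => [m|[//]] Am.
congr Some; case: (ltngtP m n) => // h.
  by have := uniq_time _ _ Am An.
by have := uniq_time _ _ An Am.
Qed.

Hypothesis hU : VLMC q U.
Hypothesis hpi : stationary_distribution q pi.
Hypothesis hU0 : forall B : set lseq, measurable B -> P (U 0%N @^-1` B) = pi B.

Lemma occ_time_prob r n : (0 < r)%N ->
  fine (P [set t | occ_time U w r t = Some n]) =
  hit_mass w [::] (word_prob pi) r n.
Proof.
move=> r0; rewrite /hit_mass -[RHS]/(fine _%:E).
rewrite -(block_event_law q pi U hU hpi hU0 n n (occ_at w [::] r)).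
by congr (fine (P _)); apply/seteqP; split => t /= /occ_timeE -> .
Qed.

(** The joint event constrains the |v| + j letters that end at index j;
summing the product formula for their probabilities makes the probability of
the condition cancel. *)
Lemma cond_wordE v j (u : word) : has_double (rev v) ->
  P [set t | block U 0 (size v) t = rev v] != 0%E -> (size u <= j)%N ->
  cond_word U v j u =
  \sum_(y <- words j | suffix u y) path_prob (next_prob q) (rev v) y.
Proof.
move=> vd v0 uj; rewrite /cond_word /cond_prob.
have vE : P [set t | block U 0 (size v) t = rev v] = (word_prob pi (rev v))%:E.
  by rewrite -{1}(size_rev v); exact: block_law hU hpi hU0 0 (rev v).
rewrite vE in v0 *.
pose Q (h : word) := (take (size v) h == rev v) && suffix u h.
have -> : [set t | block U j (size u) t = u] `&`
    [set t | block U 0 (size v) t = rev v] = [set t | Q (block U j (size v + j) t)].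
  apply/seteqP; split => t; rewrite /= /Q suffix_block ?(leq_trans uj) ?leq_addl //;
  rewrite (take_block 0).
    by move=> [/eqP-> /eqP->].
  by move=> /andP[/eqP-> /eqP->].
rewrite (block_event_law q pi U hU hpi hU0) /= big_mkcond sum_words_cat.
transitivity (word_prob pi (rev v) * (\sum_(y <- words j | suffix u y)
    path_prob (next_prob q) (rev v) y) / word_prob pi (rev v)); last first.
  by rewrite mulrC mulKf.
congr (_ / _).
rewrite -(sum_words1 _ (size v) (rev v) (fun h => word_prob pi h *
   \sum_(y <- words j | suffix u y) path_prob (next_prob q) h y)) ?size_rev //.
rewrite [RHS]big_mkcond; apply: eq_big_seq => h; rewrite mem_words => /eqP hv.
case: eqP => [->|hN]; last first.
  by rewrite big1 // => y _; rewrite /Q take_size_cat //; case: eqP.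
rewrite mulr_sumr [RHS]big_mkcond; apply: eq_big_seq => y.
rewrite mem_words => /eqP yj.
rewrite /Q take_size_cat ?size_rev // eqxx /= suffix_size_cat ?yj //.
by case: ifP => // _; exact: word_prob_cat.
Qed.

(** The letters before an occurrence of w are free, so their probabilities add
up. *)
Lemma visit_mass_word_prob n : visit_mass w [::] (word_prob pi) n =
  if (size w <= n)%N then word_prob pi w else 0.
Proof.
rewrite /visit_mass; case: leqP => [wn|nw]; last first.
  rewrite big_seq_cond big_pred0 // => h; rewrite mem_words.
  case: eqP => //= hn; apply/negbTE; apply: contraL nw => /size_suffix.
  by rewrite hn -leqNgt.
rewrite -(subnK wn) big_mkcond sum_words_cat.
rewrite -[RHS](sum_word_prob_cat pi (n - size w)).
apply: eq_bigr => s _.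
rewrite -[RHS](sum_words1 _ (size w) w (fun h => word_prob pi (s ++ h))) //.
rewrite [RHS]big_mkcond.
apply: eq_big_seq => h; rewrite mem_words => /eqP hw.
rewrite /= (suffix_size_cat w s h) ?hw // suffixE hw subnn drop0.
by [].
Qed.

End occurrence_times.

(** * Generating functions *)

Section renewal_gf.
Context {R : realType}.
Variables (g : word -> bool -> R).
Hypotheses (g_ge0 : forall h a, 0 <= g h a)
  (g_sum : forall h, g h false + g h true = 1).
Variable w : word.
Hypothesis w_renewing : renewing g w.

Lemma renewal_mass_norm n : `|renewal_mass g w n| <= 1.
Proof.
apply: word_mass_norm; first by move=> h; exact: path_prob_ge0.
by move=> m; exact: sum_path_prob.
Qed.

Lemma return_mass_norm n : `|return_mass g w n| <= 1.
Proof.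
apply: word_mass_norm; first by move=> h; exact: path_prob_ge0.
by move=> m; exact: sum_path_prob.
Qed.

(** The renewal equation u = delta_0 + f * u, in terms of generating
functions. *)
Lemma renewal_gf x S F : `|x| < 1 ->
  power_cvg (renewal_mass g w) x S -> power_cvg (return_mass g w) x F ->
  S * (1 - F) = 1.
Proof.
move=> x1 hS hF.
have hFS := power_cvg_mul _ _ _ _ _ return_mass_norm renewal_mass_norm x1 hF hS.
have := power_cvg_coef0 (renewal_mass g w) _ _ _ _ hFS.
move=> /(_ (fun n => renewal_massE g w w_renewing n.+1 isT)).
move=> /(power_cvg_unique _ _ _ _ hS).
rewrite big_nat1 renewal_mass0 {1}/return_mass /= big_mkcond big_seq1 /=.
rewrite /occ_at /occ_count /= andbF mul0r subr0 mulrBr mulr1 [S * F]mulrC => {1}->.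
by rewrite addrC addKr.
Qed.

End renewal_gf.

Section occ_gf.
Context {R : realType} {d : measure_display} {T : measurableType d}
  {P : probability T R}.
Variables (q : context -> probability bool R) (pi : probability lseq R).
Variable (U : nat -> {RV P >-> lseq}).
Hypothesis hU : VLMC q U.
Hypothesis hpi : stationary_distribution q pi.
Hypothesis hU0 : forall B : set lseq, measurable B -> P (U 0%N @^-1` B) = pi B.
Variables (w v : word).
Hypotheses (vw : suffix (rev v) w) (v_double : has_double (rev v)).
Hypothesis hv : P [set t | block U 0 (size v) t = rev v] != 0%E.
Variable x : R[i].
Hypothesis hx : `|x| < 1.

Let w_double : has_double w.
Proof.
by case/suffixP: vw => s ->; rewrite -[rev v]cats0; exact: has_double_cat.
Qed.

Let w_neq0 : w != [::].
Proof.
by case: w_double => s [b [t ->]]; rewrite -size_eq0 !size_cat addnS.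
Qed.

Lemma cond_word_path j (u : word) : (size u <= j)%N -> cond_word U v j u =
  \sum_(y <- words j | suffix u y) path_prob (next_prob q) w y.
Proof.
move=> uj; rewrite (cond_wordE q pi U hU hpi hU0 v j u v_double hv uj).
apply: eq_bigr => y _; apply/esym/path_prob_renewing => //.
exact: has_double_renewing.
Qed.

(** Conditioning on the reversal of v is the same as starting after w, of
which it is a suffix with a double letter; each term of C_w is then the
probability of an occurrence that overlaps the old one. *)
Lemma autocorrelationE :
  autocorrelation U v w x = power_sum (renewal_mass (next_prob q) w) x (size w).
Proof.
have w0 : (0 < size w)%N by rewrite lt0n size_eq0.
rewrite /power_sum big_ltn // renewal_mass0 expr0 mulr1.
congr (_ + _); rewrite big_mkcond /= big_nat [RHS]big_nat.
apply: eq_bigr => j /andP[_ jw]; rewrite renewal_mass_short //.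
case: ifP => _; last by rewrite mul0r.
by rewrite cond_word_path // size_drop subKn // ltnW.
Qed.

Lemma occ_S_cvg S : power_cvg (renewal_mass (next_prob q) w) x S ->
  occ_S U v w x = S.
Proof.
move=> hS; rewrite /occ_S autocorrelationE.
set C := power_sum _ _ _.
suff h : (fun n => \sum_(size w <= j < n) (cond_word U v j w)%:C * x ^+ j : R[i]^o)
    @ \oo --> (S - C : R[i]^o).
  rewrite (cvg_lim _ h); last exact: norm_hausdorff.
  by rewrite addrC subrK.
rewrite -(cvg_shiftn (size w)).
have -> : (fun n => \sum_(size w <= j < n + size w)
      (cond_word U v j w)%:C * x ^+ j : R[i]^o) =
    (fun n => power_sum (renewal_mass (next_prob q) w) x (n + size w) - C).
  apply: funext => n; rewrite /C /power_sum.
  rewrite [X in _ = X - _](big_cat_nat _ (leq_addl n (size w))) //=.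
  rewrite addrAC subrr add0r.
  rewrite big_nat [RHS]big_nat; apply: eq_bigr => j /andP[wj _].
  by rewrite cond_word_path // renewal_mass_long.
apply: cvgB; last exact: cvg_cst.
by rewrite (cvg_shiftn (size w) (power_sum _ x)).
Qed.

Lemma occ_gf_cvg r l : (0 < r)%N ->
  power_cvg (hit_mass w [::] (word_prob pi) r) x l -> occ_gf U w r x = l.
Proof.
move=> r0 hl; rewrite /occ_gf.
rewrite (_ : series _ = power_sum (hit_mass w [::] (word_prob pi) r) x).
  exact: power_cvg_lim.
apply: funext => n; rewrite /series /power_sum /=; apply: eq_bigr => j _.
by rewrite (occ_time_prob q pi U w w_neq0 hU hpi hU0 r j r0).
Qed.

Let hit_norm r n : `|hit_mass w [::] (word_prob pi) r n| <= 1.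
Proof.
by apply: word_mass_norm => [h|m]; [exact: word_prob_ge0|exact: sum_word_prob].
Qed.

Let word_prob_split h y : suffix w ([::] ++ h) ->
  word_prob pi (h ++ y) = word_prob pi h * path_prob (next_prob q) w y.
Proof.
move=> /= wh; rewrite (word_prob_cat q pi hpi); last first.
  by case/suffixP: wh => s ->; rewrite -[w]cats0; exact: has_double_cat.
by rewrite (path_prob_renewing _ w) //; exact: has_double_renewing.
Qed.

(** The two convolution identities become Phi1 S = pi(w) x^k / (1 - x) and
Phi_(r+1) = Phi_r F; division by S is possible as S (1 - F) = 1. *)
Lemma occ_gf_formulas :
  [/\ occ_S U v w x != 0,
      occ_gf U w 1 x =
        x ^+ size w * (fine (pi (cylinder w)))%:C / ((1 - x) * occ_S U v w x) &
      forall r : nat, (1 <= r)%N ->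
        occ_gf U w r x =
          occ_gf U w 1 x * (1 - (occ_S U v w x)^-1) ^+ r.-1].
Proof.
have g0 := next_prob_ge0 q; have g1 := next_prob_sum q.
have wr : renewing (next_prob q) w by exact: has_double_renewing.
have un := renewal_mass_norm _ g0 g1 w; have fn := return_mass_norm _ g0 g1 w.
have [S hS] := is_power_cvg _ _ un hx.
have [F hF] := is_power_cvg _ _ fn hx.
have SF := renewal_gf _ g0 g1 w wr x S F hx hS hF.
have S0 : S != 0 by apply: contra_eq_neq SF => ->; rewrite mul0r eq_sym oner_eq0.
have FE : F = 1 - S^-1.
  have -> : S^-1 = 1 - F by apply: (mulfI S0); rewrite mulfV // SF.
  by rewrite subKr.
rewrite (occ_S_cvg S hS).
have [Phi1 hPhi1] := is_power_cvg _ _ (hit_norm 1) hx.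
have hPhi r :
    power_cvg (hit_mass w [::] (word_prob pi) r.+1) x (Phi1 * F ^+ r).
  elim: r => [|r IH]; first by rewrite expr0 mulr1; exact: hPhi1.
  rewrite exprSr mulrA.
  rewrite (_ : hit_mass _ _ _ _ = fun n => \sum_(0 <= m < n.+1)
      hit_mass w [::] (word_prob pi) r.+1 m *
      return_mass (next_prob q) w (n - m)); last first.
    apply: funext => n; exact: (hit_massS _ w [::] _ word_prob_split).
  exact: power_cvg_mul.
have gfE r : occ_gf U w r.+1 x = Phi1 * F ^+ r.
  exact: (occ_gf_cvg r.+1 _ isT (hPhi r)).
have Phi1S : Phi1 * S = x ^+ size w * (word_prob pi w)%:C / (1 - x).
  have := power_cvg_mul _ _ _ _ _ (hit_norm 1) un hx hPhi1 hS.
  rewrite (_ : (fun n => _) =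
      fun n => if (size w <= n)%N then word_prob pi w else 0).
    by move=> h; apply: power_cvg_unique h _; exact: power_cvg_geometric_tail.
  apply: funext => n; rewrite -visit_mass_word_prob.
  rewrite (visit_massE _ w [::] _ word_prob_split) //.
  by rewrite suffixs0 w_neq0 implybT.
split; first exact: S0.
  rewrite gfE expr0 mulr1 -[fine _]/(word_prob pi w) invfM mulrA -Phi1S.
  by rewrite mulfK.
case=> [|r] r0; first by rewrite ltnn in r0.
by rewrite !gfE expr0 mulr1 FE.
Qed.

End occ_gf.

Theorem proposition34 (R : realType) (d : measure_display)
  (T : measurableType d) (P : probability T R)
  (q : context -> probability bool R) (pi : probability lseq R)
  (U : nat -> {RV P >-> lseq})
  (hU : VLMC q U)
  (hpi : stationary_distribution q pi)
  (hU0 : forall B : set lseq, measurable B -> P (U 0%N @^-1` B) = pi B)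
  (w v : word)
  (hwv :
    ((exists (s : word) (l : nat),
         w = s ++ w00 ++ word_pow w10 l \/
         w = s ++ w11 ++ word_pow w01 l ++ [:: false]) /\
       v = pref_word w) \/
    (exists (s : word) (l : nat),
       w = s ++ w00 ++ word_pow w10 l ++ [:: true] /\
       v = [:: true] ++ word_pow w01 l ++ w00) \/
    (exists (s : word) (l : nat),
       w = s ++ w11 ++ word_pow w01 l /\
       v = word_pow w10 l ++ w11))
  (hv : P [set t | block U 0 (size v) t = rev v] != 0%E)
  (x : R[i]) (hx : `|x| < 1) :
  [/\ occ_S U v w x != 0,
      occ_gf U w 1 x =
        x ^+ size w * (fine (pi (cylinder w)))%:C / ((1 - x) * occ_S U v w x) &
      forall r : nat, (1 <= r)%N ->
        occ_gf U w r x =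
          occ_gf U w 1 x * (1 - (occ_S U v w x)^-1) ^+ r.-1].
Proof.
have [vw v_double] := conditioning_word w v hwv.
exact: (occ_gf_formulas q pi U hU hpi hU0 w v vw v_double hv x hx).
Qed.
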